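(* Let $d_1\ge1$, $d_2\ge1$, and in $\mathbb{R}^{d_1}_x\times\mathbb{R}^{d_2}_y$ let $N=\{y_1=0\}$ with coordinates $(x,y')=(\tilde x,x'',\tilde y,y'')\in\mathbb{R}^{p_1}\times\mathbb{R}^{d_1-p_1}\times\mathbb{R}^{p_2}\times\mathbb{R}^{d_2-p_2-1}$, where $0\le p_1\le d_1$, $0\le p_2\le d_2-1$ and $(d_1-p_1)+(d_2-1-p_2)\ge1$, and let $M=\{y_1=0,\ x''=0,\ y''=0\}\subseteq N$. Then for every integer $k\ge0$ there exist Cauchy data $(u_0,u_1)$ on $N$, not both identically zero, which satisfy the constraint $\mathrm{supp}(\hat u_0,\hat u_1)\subseteq\{(\xi,\eta'):|\eta'|<|\xi|\}$ and vanish to order $k$ on $M$ (i.e. all partial derivatives of $u_0$ and $u_1$ of order at most $k$ vanish on $M$).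
   Context: The Fourier transform is taken in $(x,y')$ with dual variables $(\xi,\eta')\in\mathbb{R}^{d_1}\times\mathbb{R}^{d_2-1}$. Data satisfying this support constraint are the ''constraint-satisfying'' Cauchy data for $\partial_{y_1}^2u=\Delta_xu-\Delta_{y'}u$, giving globally defined solutions in $y_1$. *)

(* Defs.v *)
From HB Require Import structures.
From mathcomp Require Import all_boot all_order all_algebra.
From mathcomp Require Import all_classical all_reals all_analysis.
Set Implicit Arguments. Unset Strict Implicit. Unset Printing Implicit Defensive.
Import Order.TTheory GRing.Theory Num.Theory.
Import numFieldNormedType.Exports.
Local Open Scope classical_set_scope.
Local Open Scope ring_scope.

(* Points of R^n are row vectors 'rV[R]_n.
   A complex-valued function on R^n is represented by its pair
   (real part, imaginary part) of real-valued functions. *)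

Section Defs.
Variable R : realType.

Definition cfun (n : nat) := (('rV[R]_n -> R) * ('rV[R]_n -> R))%type.

Definition enorm n (v : 'rV[R]_n) : R := Num.sqrt (\sum_(i < n) v 0 i ^+ 2).
Definition dotv n (v w : 'rV[R]_n) : R := \sum_(i < n) v 0 i * w 0 i.

(* Iterated Lebesgue integral over R^n, integrating the coordinates one by one
   (for continuous absolutely integrable functions this is the Lebesgue
   integral on R^n, by Fubini-Tonelli). *)
Fixpoint iint (n : nat) : ('rV[R]_n -> \bar R) -> \bar R :=
  match n return ('rV[R]_n -> \bar R) -> \bar R with
  | 0 => fun f => f 0
  | n'.+1 => fun f =>
      (\int[@lebesgue_measure R]_t
         iint (fun v : 'rV[R]_n' => f (row_mx (\row_(j < 1) t) v)))%E
  end.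

Definition cintegrable n (u : cfun n) : Prop :=
  (iint (fun z => (`|u.1 z| + `|u.2 z|)%:E) < +oo)%E.

(* Fourier transform  \hat u(zeta) = int e^{-i z.zeta} u(z) dz,
   real and imaginary parts *)
Definition fourier_re n (u : cfun n) (zeta : 'rV[R]_n) : \bar R :=
  iint (fun z => (u.1 z * cos (dotv z zeta) + u.2 z * sin (dotv z zeta))%:E).
Definition fourier_im n (u : cfun n) (zeta : 'rV[R]_n) : \bar R :=
  iint (fun z => (u.2 z * cos (dotv z zeta) - u.1 z * sin (dotv z zeta))%:E).

Definition fourier_nonzero n (u : cfun n) : set 'rV[R]_n :=
  [set zeta | fourier_re u zeta != 0%E \/ fourier_im u zeta != 0%E].

Definition fourier_supp n (u : cfun n) : set 'rV[R]_n :=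
  closure (fourier_nonzero u).

Definition cone m l : set 'rV[R]_(m + l) :=
  [set zeta | enorm (rsubmx zeta) < enorm (lsubmx zeta)].

Definition basis_vec n (i : 'I_n) : 'rV[R]_n := delta_mx 0 i.

Fixpoint iterD n (s : seq 'I_n) (f : 'rV[R]_n -> R) : 'rV[R]_n -> R :=
  match s with
  | [::] => f
  | i :: s' => fun z => derive (iterD s' f) z (basis_vec i)
  end.

Definition smooth n (f : 'rV[R]_n -> R) : Prop :=
  (forall (s : seq 'I_n) (z : 'rV[R]_n) (i : 'I_n),
      derivable (iterD s f) z (basis_vec i)) /\
  (forall s : seq 'I_n, continuous (iterD s f)).

Definition csmooth n (u : cfun n) : Prop := smooth u.1 /\ smooth u.2.

Definition czero n (u : cfun n) : Prop :=
  forall z, u.1 z = 0 /\ u.2 z = 0.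

Definition czero_pair n (u0 u1 : cfun n) : Prop := czero u0 /\ czero u1.

Definition vanish_to_order n (k : nat) (A : set 'rV[R]_n) (u : cfun n) : Prop :=
  forall s : seq 'I_n, (size s <= k)%N ->
    forall z, A z -> iterD s u.1 z = 0 /\ iterD s u.2 z = 0.

(* On N = R^{d1}_x x R^{d2-1}_{y'} with coordinates indexed 0 .. d1+d2-2:
   x~ = indices [0, p1), x'' = [p1, d1), y~ = [d1, d1+p2), y'' = [d1+p2, ..).
   M = { x'' = 0, y'' = 0 }. *)
Definition Mset (d1 d2 p1 p2 : nat) : set 'rV[R]_(d1 + (d2 - 1)) :=
  [set z | forall i : 'I_(d1 + (d2 - 1)),
      ((p1 <= i < d1) || (d1 + p2 <= i))%N -> z 0 i = 0].

End Defs.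

(* Main.v *)
(* The entire function kernel t = (1 - cos t) / t^2 is band-limited: since
   int (1 - cos (a t)) / t^2 dt is proportional to |a| by scaling, its cosine
   transform at w is a multiple of |w+1|/2 + |w-1|/2 - |w|, which vanishes for
   |w| >= 1. Multiplying by (sin t)^(k+1) widens the band by k+1 and creates a
   zero of order k+1 at the origin; multiplying by cos (a t) moves the band to
   +-a. Taking the product over all coordinates, with a large modulation only
   in the first x-coordinate, gives an integrable smooth function whose
   spectrum lies in the cone and which vanishes to order k on every coordinate
   hyperplane, hence on M. *)
Require Import Defs.
From HB Require Import structures.
From mathcomp Require Import all_boot all_order all_algebra.
From mathcomp Require Import all_classical all_reals all_analysis.
From mathcomp Require Import measurable_realfun.
From mathcomp Require Import ring lra.
Import Order.TTheory GRing.Theory Num.Theory.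
Import numFieldNormedType.Exports.
Local Open Scope classical_set_scope.
Local Open Scope ring_scope.

(** * One-variable smooth functions and their order of vanishing at the origin *)

Section SmoothFunctions.
Context {R : realType}.
Implicit Types (f g : R -> R) (n : nat).

Fixpoint nderivable n f : Prop :=
  if n is n'.+1 then (forall x, derivable f x 1) /\ nderivable n' (derive1 f)
  else True.

Definition smooth1 f := forall n, nderivable n f.

Lemma nderivable_pred n f : nderivable n.+1 f -> nderivable n f.
Proof. by elim: n f => // n IH f [df /IH]. Qed.

Lemma derive1D_fun f g : (forall x, derivable f x 1) ->
  (forall x, derivable g x 1) -> derive1 (f + g) = derive1 f + derive1 g.
Proof.
by move=> df dg; apply/funext => x; rewrite derive1E deriveD// -!derive1E.
Qed.

Lemma derive1M_fun f g : (forall x, derivable f x 1) ->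
  (forall x, derivable g x 1) -> derive1 (f * g) = derive1 f * g + f * derive1 g.
Proof.
move=> df dg; apply/funext => x; rewrite derive1E deriveM// -!derive1E.
by rewrite addrC /GRing.scale /= [g x * _]mulrC.
Qed.

Lemma nderivableD n f g :
  nderivable n f -> nderivable n g -> nderivable n (f + g).
Proof.
elim: n f g => // n IH f g [df nf] [dg ng]; split.
  by move=> x; exact: derivableD.
by rewrite derive1D_fun//; exact: IH.
Qed.

Lemma nderivableM n f g :
  nderivable n f -> nderivable n g -> nderivable n (f * g).
Proof.
elim: n f g => // n IH f g nf ng; have [df nf'] := nf; have [dg ng'] := ng.
split; first by move=> x; exact: derivableM.
by rewrite derive1M_fun//; apply: nderivableD; apply: IH => //;
  exact: nderivable_pred.
Qed.

Lemma smooth1M f g : smooth1 f -> smooth1 g -> smooth1 (f * g).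
Proof. by move=> sf sg n; exact: nderivableM. Qed.

Lemma smooth1_derivable f x : smooth1 f -> derivable f x 1.
Proof. by move=> /(_ 1%N)[]. Qed.

Lemma smooth1_derive1 f : smooth1 f -> smooth1 (derive1 f).
Proof. by move=> sf n; have [] := sf n.+1. Qed.

Lemma smooth1_derive1n n f : smooth1 f -> smooth1 (derive1n n f).
Proof. by move=> sf; elim: n => // n; exact: smooth1_derive1. Qed.

Lemma smooth1_continuous f : smooth1 f -> continuous f.
Proof.
move=> sf x; apply/differentiable_continuous/derivable1_diffP.
exact: smooth1_derivable.
Qed.

(** Induction on the order, for all indices at once: the derivative of a member is again a member,
    so no formula for higher derivatives is needed. *)
Lemma smooth1_family {I : Type} (F : I -> R -> R) :
  (forall i, exists j, forall x : R, is_derive x 1 (F i) (F j x)) ->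
  forall i, smooth1 (F i).
Proof.
move=> dF i n; elim: n i => // n IH i; have [j dFi] := dF i; split.
  by move=> x; exact: ex_derive.
suff -> : derive1 (F i) = F j by exact: IH.
by apply/funext => x; rewrite derive1E; exact: derive_val.
Qed.

Lemma smooth1_scaled_trig (a : R) :
  smooth1 (fun t => cos (a * t)) /\ smooth1 (fun t => sin (a * t)).
Proof.
pose F (p : R * R) t := p.1 * cos (a * t) + p.2 * sin (a * t).
have sF p : smooth1 (F p).
  (* The span of [cos (a * t)] and [sin (a * t)] is stable under differentiation; this pair holds
     the coefficients of the derivative. *)
  apply: smooth1_family => -[b c]; exists (a * c, - a * b) => x.
  rewrite /F /=; apply: is_derive_eq; rewrite /GRing.scale /=; ring.
split.
- have := sF (1, 0); congr (smooth1 _); apply/funext => t; rewrite /F /=; ring.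
- have := sF (0, 1); congr (smooth1 _); apply/funext => t; rewrite /F /=; ring.
Qed.

(** The bound is strict: derivatives of orders [0] to [n - 1] vanish, so vanishing to order [k] in
    the sense of [vanish_to_order] corresponds to [flat k.+1]. *)
Definition flat n f := forall m, (m < n)%N -> derive1n m f 0 = 0.

Lemma flatS n f : flat n.+1 f <-> f 0 = 0 /\ flat n (derive1 f).
Proof.
split=> [ff|[f0 ff] [|m] mn //].
  by split=> [|m mn]; [exact: (ff 0%N)|rewrite -derive1Sn; exact: ff].
by rewrite derive1Sn; exact: ff.
Qed.

Lemma flatD n f g : smooth1 f -> smooth1 g ->
  flat n f -> flat n g -> flat n (f + g).
Proof.
elim: n f g => // n IH f g sf sg /flatS[f0 ff] /flatS[g0 fg]; apply/flatS.
split; first by rewrite /GRing.add /= f0 g0 addr0.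
rewrite derive1D_fun; [|by move=> x; exact: smooth1_derivable..].
by apply: IH => //; exact: smooth1_derive1.
Qed.

Lemma flat_pred n f : flat n.+1 f -> flat n f.
Proof. by move=> ff m mn; apply: ff; exact: ltnW. Qed.

Lemma flatMr n f g : smooth1 f -> smooth1 g -> flat n f -> flat n (f * g).
Proof.
elim: n f g => // n IH f g sf sg ff; have /flatS[f0 ff'] := ff.
apply/flatS; split; first by rewrite /GRing.mul /= f0 mul0r.
rewrite derive1M_fun; [|by move=> x; exact: smooth1_derivable..].
have [sf' sg'] := (smooth1_derive1 _ sf, smooth1_derive1 _ sg).
by apply: flatD; do ?exact: smooth1M; apply: IH => //; exact: flat_pred.
Qed.

(** By the product rule the derivative is [f' g + f g']. The first term gains an order by induction,
    since [f'] loses one; the second is as flat as [f]. *)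
Lemma flatMS n f g : smooth1 f -> smooth1 g -> flat n f -> g 0 = 0 ->
  flat n.+1 (f * g).
Proof.
move=> + sg + g0; elim: n f => [|n IH] f sf ff.
  by case=> // _; rewrite derive1n0 /GRing.mul /= g0 mulr0.
have /flatS[f0 ff'] := ff.
apply/flatS; split; first by rewrite /GRing.mul /= f0 mul0r.
rewrite derive1M_fun; [|by move=> x; exact: smooth1_derivable..].
have [sf' sg'] := (smooth1_derive1 _ sf, smooth1_derive1 _ sg).
apply: flatD; do ?exact: smooth1M; first exact: IH.
exact: flatMr.
Qed.

End SmoothFunctions.

(** * Continuous Lebesgue-integrable functions on the line *)

Section ContinuousIntegrable.
Context {R : realType}.
Implicit Types (f g : R -> R) (c : R).

Local Notation mu := (@lebesgue_measure R).
Local Notation mT := (@measurableT _ (measurableTypeR R)).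

Definition L1 f := continuous f /\ mu.-integrable [set: R] (EFin \o f).

Definition Rint f : R := \int[mu]_t f t.

Lemma measurable_EFin_continuous f :
  continuous f -> measurable_fun [set: measurableTypeR R] (EFin \o f).
Proof. by move=> cf; apply/measurable_EFinP; exact: continuous_measurable_fun. Qed.

Lemma L1_integral f : L1 f -> (\int[mu]_t (f t)%:E = (Rint f)%:E)%E.
Proof. by move=> [_ If]; rewrite fineK//; exact: (integrable_fin_num mT If). Qed.

Lemma L1_le f g : L1 g -> continuous f -> (forall t, `|f t| <= `|g t|) -> L1 f.
Proof.
move=> [_ Ig] cf fg; split=> //; apply: (le_integrable mT _ _ Ig).
  exact: measurable_EFin_continuous.
by move=> t _ /=; rewrite lee_fin.
Qed.

Lemma L1_ge0 f : continuous f -> (forall t, 0 <= f t) ->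
  (\int[mu]_t (f t)%:E < +oo)%E -> L1 f.
Proof.
move=> cf f0 fy; split=> //; apply/integrableP; split.
  exact: measurable_EFin_continuous.
by under eq_integral do rewrite /= ger0_norm//.
Qed.

Lemma L1_norm f : L1 f -> L1 (fun t => `|f t|).
Proof.
move=> If; apply: (L1_le _ _ If) => [t|t]; last by rewrite normr_id.
by apply: (cvg_comp _ _ (If.1 t)); exact: norm_continuous.
Qed.

Lemma L1Z c f : L1 f -> L1 (fun t => c * f t).
Proof.
move=> [cf If]; split; last exact: (integrableZl mT c If).
by move=> t; apply: cvgM; [exact: cvg_cst|exact: cf].
Qed.

Lemma L1D f g : L1 f -> L1 g -> L1 (fun t => f t + g t).
Proof.
move=> [cf If] [cg Ig]; split; last exact: (integrableD mT If Ig).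
by move=> t; apply: cvgD; [exact: cf|exact: cg].
Qed.

Lemma L1M f g : L1 f -> continuous g -> (forall t, `|g t| <= 1) ->
  L1 (fun t => f t * g t).
Proof.
move=> If cg g1; apply: (L1_le _ _ If) => t.
  by apply: cvgM; [exact: If.1|exact: cg].
by rewrite normrM ler_piMr.
Qed.

Lemma RintZ c f : L1 f -> Rint (fun t => c * f t) = c * Rint f.
Proof. by move=> [_ If]; exact: (RintegralZl c mT If). Qed.

Lemma RintD f g : L1 f -> L1 g -> Rint (fun t => f t + g t) = Rint f + Rint g.
Proof. by move=> [_ If] [_ Ig]; exact: (RintegralD mT If Ig). Qed.

Lemma Rint_lin c1 c2 f g : L1 f -> L1 g ->
  L1 (fun t => c1 * f t + c2 * g t) /\
  Rint (fun t => c1 * f t + c2 * g t) = c1 * Rint f + c2 * Rint g.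
Proof.
move=> If Ig; have [Jf Jg] := (L1Z c1 _ If, L1Z c2 _ Ig).
by split; [exact: L1D|rewrite RintD// !RintZ].
Qed.

(** Lebesgue measure is invariant under [t |-> - t], so the integral equals its own opposite. *)
Lemma Rint_odd f : L1 f -> (forall t, f (- t) = - f t) -> Rint f = 0.
Proof.
move=> [cf If] fN.
have E : (\int[mu]_t (f t)%:E = \int[mu]_t (f (- t))%:E)%E.
  rewrite -[RHS](@integral_pushforward _ _ (measurableTypeR R)
    (measurableTypeR R) R (-%R) _ mu setT (EFin \o f))//=.
  - by apply: eq_measure_integral => A mA _; rewrite [RHS]lebesgue_measureN.
  - exact: measurable_EFin_continuous.
  - have := integrableZl mT (-1) If; apply: eq_integrable => // t _ /=.
    by rewrite fN -EFinM mulN1r.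
have : Rint f = - Rint f.
  rewrite -mulN1r -RintZ//; congr fine; rewrite E.
  by apply: eq_integral => t _; rewrite fN mulN1r.
lra.
Qed.

End ContinuousIntegrable.

(** * Smoothness of power series with factorially decaying coefficients *)

Section EntireSeries.
Context {R : realType}.
Implicit Types (c : nat -> R) (x : R).

(** Domination by the exponential series gives convergence everywhere, and the bound survives formal
    differentiation because [(n + 1) / (n + 1)! = 1 / n!]. *)
Definition inv_fact_bounded c := forall n, `|c n| <= (n`!%:R)^-1.

Lemma inv_fact_bounded_cvg c x : inv_fact_bounded c -> cvgn (pseries c x).
Proof.
move=> cb; apply: normed_cvg.
apply: series_le_cvg; last exact: (is_cvg_series_exp_coeff `|x|).
- by move=> n; rewrite normr_ge0.
- by move=> n; rewrite /exp_coeff /= divr_ge0.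
- by move=> n /=; rewrite /exp_coeff /= normrM normrX mulrC ler_wpM2l.
Qed.

Lemma inv_fact_bounded_diffs c :
  inv_fact_bounded c -> inv_fact_bounded (pseries_diffs c).
Proof.
move=> cb n; rewrite /pseries_diffs normrM normr_nat.
apply: le_trans (ler_wpM2l _ (cb n.+1)) _ => //.
by rewrite factS natrM invfM mulVKf.
Qed.

Lemma smooth1_pseries c : inv_fact_bounded c ->
  smooth1 (fun x => limn (pseries c x)).
Proof.
move=> cb; pose F (p : {c : nat -> R | inv_fact_bounded c}) x :=
  limn (pseries (sval p) x).
apply: (smooth1_family F _ (exist _ c cb)) => -[d db].
exists (exist _ (pseries_diffs d) (inv_fact_bounded_diffs _ db)) => x.
(* Any radius beyond [|x|] would do, since the series converge everywhere. *)
apply: (@pseries_snd_diffs _ d (`|x| + 1)).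
- exact: inv_fact_bounded_cvg.
- exact/inv_fact_bounded_cvg/inv_fact_bounded_diffs.
- exact/inv_fact_bounded_cvg/inv_fact_bounded_diffs/inv_fact_bounded_diffs.
- by rewrite [ltRHS]ger0_norm ?ltrDl// addr_ge0.
Qed.

End EntireSeries.

(** * The band-limited kernel and its cosine transform *)

Section Kernel.
Context {R : realType}.
Implicit Types t w : R.

(** The Taylor coefficients of [1 - cos t], shifted down by two. Starting from the series rather
    than the quotient makes smoothness at [0] automatic. *)
Definition kernel_coeff (n : nat) : R :=
  - ((~~ odd n)%:R * (-1) ^+ n.+2./2 * (n.+2`!%:R)^-1).

(* the entire function t |-> (1 - cos t) / t^2 = (sin (t/2) / (t/2))^2 / 2 *)
Definition kernel t : R := limn (pseries kernel_coeff t).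

Lemma kernel_coeff_bounded : inv_fact_bounded kernel_coeff.
Proof.
move=> n; rewrite /kernel_coeff normrN !normrM normfV !normr_nat normrX normrN.
rewrite normr1 expr1n mulr1; apply: (@le_trans _ _ (n.+2`!%:R)^-1).
  by case: odd => /=; rewrite ?mul1r// mul0r.
rewrite lef_pV2 ?posrE ?ltr0n ?fact_gt0// ler_nat.
by apply: leq_fact; rewrite -addn2 leq_addr.
Qed.

Lemma smooth1_kernel : smooth1 kernel.
Proof. exact/smooth1_pseries/kernel_coeff_bounded. Qed.

Lemma kernelE t : t ^+ 2 * kernel t = 1 - cos t.
Proof.
have cvk : pseries kernel_coeff t @ \oo --> kernel t.
  exact/inv_fact_bounded_cvg/kernel_coeff_bounded.
have cvc : series (cos_coeff t) (n + 2)%N @[n --> \oo] --> cos t.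
  rewrite (cvg_shiftn 2 (series (cos_coeff t))).
  by rewrite unlock; exact: is_cvg_series_cos_coeff.
have cvl : (fun n => t ^+ 2 * pseries kernel_coeff t n) @ \oo -->
    t ^+ 2 * kernel t by exact: cvgM (cvg_cst _) cvk.
rewrite -(cvg_lim _ cvl)//; apply/cvg_lim => //.
(* The identity holds already for partial sums: the first two terms of the cosine series are [1] and
   [0], and the rest is [- t ^+ 2] times the kernel series. *)
rewrite [X in X @ _ --> _](_ : _ =
    fun n => 1 - series (cos_coeff t) (n + 2)%N); last first.
  apply/funext => n; rewrite /series /= addn2 !big_nat_recl//= {1 2}/cos_coeff /=.
  rewrite mulr_sumr expr0 expr1 fact0 !mul1r divr1 !mul0r add0r opprD.
  rewrite invr1 addrA subrr add0r -sumrN; apply: eq_bigr => i _.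
  rewrite /kernel_coeff /cos_coeff /= negbK -exprnP.
  rewrite !mulNr mulrN !exprS; congr (- _).
  by move: (_ `!%:R^-1) ((-1) ^+ _); rewrite ?expr0 => a b; ring.
exact: cvgB (cvg_cst _) cvc.
Qed.

Lemma kernel0 : kernel 0 = 2^-1.
Proof.
apply/cvg_lim => //; rewrite -(cvg_shiftS (pseries kernel_coeff 0)).
rewrite [X in X @ _ --> _](_ : _ = fun=> 2^-1); first exact: cvg_cst.
apply/funext => n; rewrite /pseries /series /= big_nat_recl//= big1 ?addr0.
  by rewrite /kernel_coeff /= !expr0 expr1 mulr1 mul1r mulN1r opprK.
by move=> i _; rewrite expr0n mulr0.
Qed.

Lemma kernelN t : kernel (- t) = kernel t.
Proof.
have [->|t0] := eqVneq t 0; first by rewrite oppr0.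
apply: (mulfI (expf_neq0 2 t0)).
by rewrite kernelE -(sqrrN t) kernelE cosN.
Qed.

Lemma kernel_ge0 t : 0 <= kernel t.
Proof.
have [->|t0] := eqVneq t 0; first by rewrite kernel0.
have t2 : 0 < t ^+ 2 by rewrite exprn_even_gt0.
by rewrite -(pmulr_rge0 _ t2) kernelE subr_ge0 cos_le1.
Qed.

Lemma continuous_kernel : continuous kernel.
Proof. exact/smooth1_continuous/smooth1_kernel. Qed.

Lemma kernel_bounded : exists K, forall t, kernel t <= K * (oneDsqr t)^-1.
Proof.
have [c _ cmax] := @EVT_max R kernel (-1) 1 (le_trans (lerN10 _) ler01)
  (continuous_subspaceT continuous_kernel).
(* Always [t ^+ 2 * kernel t = 1 - cos t <= 2]. On [[-1, 1]] the remaining [kernel t] is at most the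
   maximum [kernel c]; outside it is at most [t ^+ 2 * kernel t], hence at most [2]. *)
exists (kernel c + 4) => t; rewrite ler_pdivlMr ?(lt_le_trans ltr01 (oneDsqr_ge1 _))//.
rewrite /oneDsqr mulrDr mulr1 [kernel t * _]mulrC kernelE.
have := kernel_ge0 c; have := cos_geN1 t.
have [t1|t1] := lerP `|t| 1.
  have : kernel t <= kernel c by apply: cmax; rewrite in_itv /= -ler_norml.
  lra.
have : kernel t <= t ^+ 2 * kernel t.
  by rewrite ler_peMl ?kernel_ge0// -real_normK ?num_real// exprn_ege1// ltW.
rewrite kernelE; lra.
Qed.

Lemma L1_kernel : L1 kernel.
Proof.
have [K hK] := kernel_bounded.
have cV : continuous (fun t : R => (oneDsqr t)^-1).
  by move=> t; exact: continuous_oneDsqrV.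
have IV : L1 (fun t : R => (oneDsqr t)^-1).
  apply: L1_ge0 => //.
  rewrite ge0_symfun_integralT//.
  - by rewrite -set_itvcy integral0y_oneDsqr -EFinM ltry.
  - by move=> t /=; rewrite /oneDsqr sqrrN.
apply: L1_le (L1Z K _ IV) continuous_kernel _ => t.
by rewrite ger0_norm ?kernel_ge0//; exact: le_trans (hK t) (ler_norm _).
Qed.

(** Substitution by [a * t] when [a > 0]; evenness of the kernel handles negative [a]. *)
Lemma integral_kernel_scale (a : R) : a != 0 ->
  (\int[@lebesgue_measure R]_t (`|a| * kernel (a * t))%:E =
   \int[@lebesgue_measure R]_t (kernel t)%:E)%E.
Proof.
wlog a0 : a / 0 < a => [H|_].
  case: (ltrgt0P a) => // a0 _.
    by rewrite -(H _ a0 (lt0r_neq0 a0)) gtr0_norm.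
  have Na0 : 0 < - a by rewrite oppr_gt0.
  rewrite -(H _ Na0 (lt0r_neq0 Na0)); apply: eq_integral => t _.
  by rewrite gtr0_norm// (mulNr a t) kernelN mulNr.
have dF (x : R) : is_derive x 1 ( *%R a) a.
  by apply: is_derive_eq; rewrite /GRing.scale /= mulr1.
have F' : derive1 ( *%R a) = cst a.
  by apply/funext => x; rewrite derive1E; exact: derive_val.
rewrite [RHS](@increasing_ge0_integration_by_substitutionT R ( *%R a)).
- by apply: eq_integral => t _; rewrite gtr0_norm// F' mulrC.
- by move=> x y xy; rewrite ltr_pM2l.
- by rewrite F'; exact: cst_continuous.
- by rewrite F'; exact: is_cvg_cst.
- by rewrite F'; exact: is_cvg_cst.
- by move=> x; exact: ex_derive.
- by apply: gt0_cvgMrNy => //; exact: cvg_id.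
- by apply: gt0_cvgMry => //; exact: cvg_id.
- exact: continuous_kernel.
- exact: kernel_ge0.
Qed.

Lemma Rint_kernel_scale (a : R) :
  L1 (fun t => a ^+ 2 * kernel (a * t)) /\
  Rint (fun t => a ^+ 2 * kernel (a * t)) = `|a| * Rint kernel.
Proof.
have [->|a0] := eqVneq a 0.
  rewrite normr0 mul0r (_ : (fun t => _) = fun t => 0 * kernel t).
    have Ik := L1_kernel.
    by rewrite RintZ// mul0r; split=> //; exact: L1Z.
  by apply/funext => t; rewrite expr0n !mul0r.
have Ia : L1 (fun t => `|a| * kernel (a * t)).
  apply: L1_ge0.
  - move=> t; apply: (@cvgM _ _ _ _ (cst `|a|) (fun t => kernel (a * t))).
      exact: cvg_cst.
    apply: (@continuous_comp _ _ _ ( *%R a) kernel).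
      exact: mulrl_continuous.
    exact: continuous_kernel.
  - by move=> t; rewrite mulr_ge0// kernel_ge0.
  - by rewrite integral_kernel_scale// L1_integral ?ltry//; exact: L1_kernel.
rewrite (_ : (fun t => _) = fun t => `|a| * (`|a| * kernel (a * t))).
  split; first exact: L1Z.
  rewrite RintZ//; congr (_ * fine _); exact: integral_kernel_scale.
by apply/funext => t; rewrite mulrA -expr2 real_normK ?num_real.
Qed.

(** Away from [0], each [a ^+ 2 * kernel (a * t)] is [(1 - cos (a * t)) / t ^+ 2]. The identity is
    then the product formula for [cos t * cos (w * t)]; the weights [1/2], [1/2], [-1] sum to zero,
    so the constants cancel. *)
Lemma kernel_cosE t w : kernel t * cos (w * t) =
  2^-1 * ((w + 1) ^+ 2 * kernel ((w + 1) * t)) +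
  2^-1 * ((w - 1) ^+ 2 * kernel ((w - 1) * t)) - w ^+ 2 * kernel (w * t).
Proof.
have [->|t0] := eqVneq t 0; first by rewrite !mulr0 cos0; field.
apply: (mulfI (expf_neq0 2 t0)).
have E a : t ^+ 2 * (a ^+ 2 * kernel (a * t)) = 1 - cos (a * t).
  by rewrite mulrA -exprMn [t * a]mulrC kernelE.
rewrite mulrBr mulrDr ![t ^+ 2 * (2^-1 * _)]mulrCA !E mulrA kernelE.
rewrite (_ : (w + 1) * t = w * t + t); last by ring.
rewrite (_ : (w - 1) * t = w * t - t); last by ring.
by rewrite cosD cosB; field.
Qed.

Lemma Rint_kernel_cos w : 1 <= `|w| -> Rint (fun t => kernel t * cos (w * t)) = 0.
Proof.
move=> w1; rewrite (_ : (fun t => _) = fun t =>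
  2^-1 * ((w + 1) ^+ 2 * kernel ((w + 1) * t)) +
  2^-1 * ((w - 1) ^+ 2 * kernel ((w - 1) * t)) +
  (- 1) * (w ^+ 2 * kernel (w * t))); last first.
  by apply/funext => t; rewrite kernel_cosE mulN1r.
have [I1 E1] := Rint_kernel_scale (w + 1).
have [I2 E2] := Rint_kernel_scale (w - 1).
have [I3 E3] := Rint_kernel_scale w.
have [I12 E12] := Rint_lin 2^-1 2^-1 _ _ I1 I2.
rewrite RintD//; last exact: L1Z.
rewrite E12 E1 E2 (RintZ (- 1))// E3.
set c := Rint kernel.
(* For [|w| >= 1] the numbers [w + 1], [w - 1] and [w] share a weak sign, and on a half-line the
   absolute value is linear. *)
suff h : 2^-1 * `|w + 1| + 2^-1 * `|w - 1| - `|w| = 0.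
  by rewrite -[RHS](mul0r c) -h; ring.
move: w1; rewrite ler_normr => /orP[w1|w1].
  by rewrite !ger0_norm; lra.
by rewrite !ler0_norm; lra.
Qed.

End Kernel.

(** * Modulation of band-limited functions *)

Section BandLimited.
Context {R : realType}.
Implicit Types (f : R -> R) (t w a : R).

Definition fourier_vanishes f w :=
  Rint (fun t => f t * cos (w * t)) = 0 /\
  Rint (fun t => f t * sin (w * t)) = 0.

Lemma continuous_cosM w : continuous (fun t : R => cos (w * t)).
Proof. exact: smooth1_continuous (smooth1_scaled_trig w).1. Qed.

Lemma continuous_sinM w : continuous (fun t : R => sin (w * t)).
Proof. exact: smooth1_continuous (smooth1_scaled_trig w).2. Qed.

Lemma normr_cos_le1 t : `|cos t| <= 1.
Proof. by rewrite ler_norml cos_geN1 cos_le1. Qed.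

Lemma normr_sin_le1 t : `|sin t| <= 1.
Proof. by rewrite ler_norml sin_geN1 sin_le1. Qed.

Lemma L1_cos f w : L1 f -> L1 (fun t => f t * cos (w * t)).
Proof.
by move=> If; apply: L1M => // [|t]; [exact: continuous_cosM|exact: normr_cos_le1].
Qed.

Lemma L1_sin f w : L1 f -> L1 (fun t => f t * sin (w * t)).
Proof.
by move=> If; apply: L1M => // [|t]; [exact: continuous_sinM|exact: normr_sin_le1].
Qed.

(** The product-to-sum formulas express all four integrals as half sums or half differences of
    transforms of [f] at [w + a] and [w - a]. *)
Lemma fourier_vanishes_modulate f a w : L1 f ->
  fourier_vanishes f (w + a) -> fourier_vanishes f (w - a) ->
  fourier_vanishes (fun t => f t * cos (a * t)) w /\
  fourier_vanishes (fun t => f t * sin (a * t)) w.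
Proof.
move=> If [c1 s1] [c2 s2].
have [Ic Is] := (fun w => L1_cos f w If, fun w => L1_sin f w If).
have E t : (w + a) * t = w * t + a * t by ring.
have F t : (w - a) * t = w * t - a * t by ring.
do ! split.
- rewrite (_ : (fun t => _) = fun t =>
    2^-1 * (f t * cos ((w + a) * t)) + 2^-1 * (f t * cos ((w - a) * t))).
    by have [_ ->] := Rint_lin 2^-1 2^-1 _ _ (Ic (w + a)) (Ic (w - a));
      rewrite c1 c2; ring.
  by apply/funext => t; rewrite E F cosD cosB; field.
- rewrite (_ : (fun t => _) = fun t =>
    2^-1 * (f t * sin ((w + a) * t)) + 2^-1 * (f t * sin ((w - a) * t))).
    by have [_ ->] := Rint_lin 2^-1 2^-1 _ _ (Is (w + a)) (Is (w - a));
      rewrite s1 s2; ring.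
  by apply/funext => t; rewrite E F sinD sinB; field.
- rewrite (_ : (fun t => _) = fun t =>
    2^-1 * (f t * sin ((w + a) * t)) + (- 2^-1) * (f t * sin ((w - a) * t))).
    by have [_ ->] := Rint_lin 2^-1 (- 2^-1) _ _ (Is (w + a)) (Is (w - a));
      rewrite s1 s2; ring.
  by apply/funext => t; rewrite E F sinD sinB; field.
- rewrite (_ : (fun t => _) = fun t =>
    (- 2^-1) * (f t * cos ((w + a) * t)) + 2^-1 * (f t * cos ((w - a) * t))).
    by have [_ ->] := Rint_lin (- 2^-1) 2^-1 _ _ (Ic (w + a)) (Ic (w - a));
      rewrite c1 c2; ring.
  by apply/funext => t; rewrite E F cosD cosB; field.
Qed.

Definition window k t : R := kernel t * sin t ^+ k.

Lemma windowS k :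
  window k.+1 = fun t => window k t * sin (1 * t).
Proof. by apply/funext => t; rewrite /window exprSr mulrA mul1r. Qed.

Lemma window0 : window 0 = kernel.
Proof. by apply/funext => t; rewrite /window expr0 mulr1. Qed.

Lemma L1_window k : L1 (window k).
Proof.
elim: k => [|k IH]; first by rewrite window0; exact: L1_kernel.
by rewrite windowS; exact: L1_sin.
Qed.

Lemma smooth1_window k : smooth1 (window k).
Proof.
elim: k => [|k IH]; first by rewrite window0; exact: smooth1_kernel.
by rewrite windowS; apply: smooth1M => //; exact: (smooth1_scaled_trig 1).2.
Qed.

Lemma flat_window k : flat k (window k).
Proof.
elim: k => [//|k IH]; rewrite windowS; apply: flatMS => //.
- exact: smooth1_window.
- exact: (smooth1_scaled_trig 1).2.
- by rewrite mulr0 sin0.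
Qed.

(** Each factor [sin t] is a modulation at frequency [1], moving the band edge out by one. For the
    kernel itself the sine part vanishes by parity. *)
Lemma fourier_vanishes_window k w :
  k.+1%:R <= `|w| -> fourier_vanishes (window k) w.
Proof.
elim: k w => [|k IH] w kw.
  rewrite window0; split; first exact: Rint_kernel_cos.
  apply: Rint_odd => [|t]; first by apply: L1_sin; exact: L1_kernel.
  by rewrite kernelN mulrN sinN mulrN.
rewrite windowS.
(* By the triangle inequality, [w + 1] and [w - 1] still lie outside the narrower band. *)
have H u : `|u - w| <= 1 -> k.+1%:R <= `|u|.
  move=> u1; move: kw; rewrite -natr1 => kw.
  have := ler_normB u (u - w); rewrite (_ : u - (u - w) = w); last by ring.
  lra.
have [] // := fourier_vanishes_modulate (window k) 1 w (L1_window k).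
- by apply/IH/H; rewrite addrAC subrr add0r normr1.
- by apply/IH/H; rewrite addrAC subrr add0r normrN1.
Qed.

Definition wave k a t : R := window k t * cos (a * t).

Lemma L1_wave k a : L1 (wave k a).
Proof. exact/L1_cos/L1_window. Qed.

Lemma smooth1_wave k a : smooth1 (wave k a).
Proof. exact: smooth1M (smooth1_window k) (smooth1_scaled_trig a).1. Qed.

Lemma flat_wave k a : flat k (wave k a).
Proof.
apply: (flatMr _ _ _ (smooth1_window k)); last exact: flat_window.
exact: (smooth1_scaled_trig a).1.
Qed.

Lemma fourier_vanishes_wave k a w :
  k.+1%:R <= `|w + a| -> k.+1%:R <= `|w - a| -> fourier_vanishes (wave k a) w.
Proof.
by move=> wa1 wa2; have [] // := fourier_vanishes_modulate (window k) a w
  (L1_window k) (fourier_vanishes_window k _ wa1) (fourier_vanishes_window k _ wa2).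
Qed.

(** All factors are nonzero: [sin t > 0] since [t < pi], a zero of the kernel would force
    [cos t = 1], and [|a * t| < 1 <= pi / 2] keeps the modulation positive. *)
Lemma wave_neq0 k a t : 0 < t <= 1 -> `|a * t| < 1 -> wave k a t != 0.
Proof.
move=> /andP[t0 t1] at1.
have st : 0 < sin t.
  by apply: sin_gt0_pi => //; rewrite t0 (le_lt_trans t1)// (lt_le_trans _ (pi_ge2 _))// ltr1n.
have kt : kernel t != 0.
  apply/eqP => kt0; have := kernelE t; rewrite kt0 mulr0 => ct.
  have := cos2Dsin2 t; rewrite (_ : cos t = 1); last lra.
  by have := exprn_gt0 2 st; lra.
have ct : 0 < cos (a * t).
  apply: cos_gt0_pihalf; move: at1; rewrite ltr_norml => /andP[].
  have := pi_ge2 R; lra.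
by rewrite /wave /window !mulf_neq0// ?expf_neq0 ?gt_eqF.
Qed.

End BandLimited.

(** * Tensor products: derivatives, integrability and Fourier transform *)

Section Tensor.
Context {R : realType}.

Definition tensor n (f : 'I_n -> R -> R) (z : 'rV[R]_n) : R :=
  \prod_(i < n) f i (z 0 i).

Lemma continuous_tensor n (f : 'I_n -> R -> R) :
  (forall i, continuous (f i)) -> continuous (tensor n f).
Proof.
move=> cf; apply: continuous_big => [|i _].
  exact: mul_continuous.
move=> z; apply: (@continuous_comp _ _ _ (fun z : 'rV[R]_n => z 0 i) (f i)).
  exact: coord_continuous.
exact: cf.
Qed.

(** Along [basis_vec R i] only the factor [i] moves, so the difference quotient is the one-variable
    quotient times the constant [c]. *)
Lemma is_derive_tensor n (f : 'I_n -> R -> R) (z : 'rV[R]_n) (i : 'I_n) :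
  derivable (f i) (z 0 i) 1 ->
  is_derive z (basis_vec R i) (tensor n f)
    (tensor n (fun j => if j == i then derive1 (f j) else f j) z).
Proof.
move=> df; pose c := \prod_(j < n | j != i) f j (z 0 j).
have E h : h^-1 *: ((tensor n f \o shift z) (h *: basis_vec R i) - tensor n f z) =
    c * (h^-1 *: ((f i \o shift (z 0 i)) (h *: 1) - f i (z 0 i))).
  rewrite /tensor /= (bigD1 i)//= [in X in _ - X](bigD1 i)//=.
  rewrite !mxE !eqxx /= (eq_bigr (fun j => f j (z 0 j))) => [|j ji].
    by rewrite -/c /GRing.scale /=; ring.
  by rewrite !mxE eqxx (negbTE ji) mulr0 add0r.
have V : tensor n (fun j => if j == i then derive1 (f j) else f j) z =
    c * derive1 (f i) (z 0 i).
  rewrite /tensor (bigD1 i)//= eqxx mulrC; congr (_ * _).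
  by apply: eq_bigr => j /negbTE ->.
rewrite V derive1E.
have cv : h^-1 *: ((tensor n f \o shift z) (h *: basis_vec R i) - tensor n f z)
    @[h --> (0 : R)^'] --> c * derive (f i) (z 0 i) 1.
  by under eq_cvg do rewrite E; exact: cvgM (cvg_cst c) df.
split; first exact: (cvgP _ cv).
exact: cvg_lim cv.
Qed.

Lemma iterD_tensor n (s : seq 'I_n) (f : 'I_n -> R -> R) :
  (forall i, smooth1 (f i)) ->
  Defs.iterD s (tensor n f) = tensor n (fun i => derive1n (count_mem i s) (f i)).
Proof.
move=> sf; elim: s => [|i s IH] //=; apply/funext => z; rewrite IH.
have := is_derive_tensor _ (fun i => derive1n (count_mem i s) (f i)) z i
  (smooth1_derivable _ _ (smooth1_derive1n _ _ (sf i))).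
move=> /@derive_val ->; congr (tensor _ _ _); apply/funext => j.
by rewrite eq_sym; case: eqVneq.
Qed.

Lemma smooth_tensor n (f : 'I_n -> R -> R) :
  (forall i, smooth1 (f i)) -> smooth (tensor n f).
Proof.
move=> sf; have sD s i := smooth1_derive1n (count_mem i s) _ (sf i).
split=> [s z i|s]; rewrite iterD_tensor//.
  exact/ex_derive/is_derive_tensor/smooth1_derivable.
by apply: continuous_tensor => i; exact: smooth1_continuous.
Qed.

(** [A] and [B] are the real and imaginary parts of the Fourier transform at [zeta]. The amplitude
    [c] and phase [th] are general so that the induction can absorb the factor and the phase [w * t]
    of the first coordinate. *)
Lemma iint_tensor n (f : 'I_n -> R -> R) (zeta : 'rV[R]_n) :
  (forall i, L1 (f i)) ->
  exists A B, (forall c th,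
    iint (fun z => (c * tensor n f z * cos (th + dotv z zeta))%:E) =
      (c * (A * cos th + B * sin th))%:E) /\
    ((exists i, fourier_vanishes (f i) (zeta 0 i)) -> A = 0 /\ B = 0).
Proof.
elim: n f zeta => [|n IH] f zeta If.
  exists 1, 0; split=> [c th|[[]//]].
  by rewrite /= /tensor /dotv !big_ord0 addr0 mulr1 mul1r mul0r addr0.
have [A [B [AB AB0]]] := IH (fun i => f (lift ord0 i))
  (\row_i zeta 0 (lift ord0 i)) (fun i => If _).
pose w := zeta 0 ord0.
pose al := Rint (fun t => f ord0 t * cos (w * t)).
pose be := Rint (fun t => f ord0 t * sin (w * t)).
(* Real and imaginary parts of [(A + i B) (al - i be)]. *)
exists (A * al + B * be), (B * al - A * be); split=> [c th|[i]].
  have [Ic Is] := (L1_cos _ w (If ord0), L1_sin _ w (If ord0)).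
  have [IL EL] := Rint_lin (c * (A * cos th + B * sin th))
    (c * (B * cos th - A * sin th)) _ _ Ic Is.
  rewrite /= [RHS](_ : _ = (c * (A * cos th + B * sin th) * al +
    c * (B * cos th - A * sin th) * be)%:E); last by congr EFin; ring.
  rewrite -EL -L1_integral//; apply: eq_integral => t _.
  rewrite [RHS](_ : _ = (c * f ord0 t * (A * cos (th + w * t) +
    B * sin (th + w * t)))%:E); last by rewrite cosD sinD; congr EFin; ring.
  rewrite -AB; congr iint; apply/funext => v; congr EFin.
  have E0 : row_mx (\row_(j < 1) t) v 0 (ord0 : 'I_(1 + n)) = t.
    transitivity (row_mx (\row_(j < 1) t) v 0 (lshift n ord0)).
      by congr (row_mx _ _ _ _); exact/val_inj.
    by rewrite row_mxEl mxE.
  have ES i : row_mx (\row_(j < 1) t) v 0 (lift ord0 i : 'I_(1 + n)) = v 0 i.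
    transitivity (row_mx (\row_(j < 1) t) v 0 (rshift 1 i)).
      by congr (row_mx _ _ _ _); exact/val_inj.
    by rewrite row_mxEr.
  have -> : tensor n.+1 f (row_mx (\row_(j < 1) t) v) =
      f ord0 t * tensor n (fun i => f (lift ord0 i)) v.
    rewrite /tensor big_ord_recl E0; congr (_ * _).
    by apply: eq_bigr => i _; congr (f _ _); exact: ES.
  have -> : dotv (row_mx (\row_(j < 1) t) v : 'rV_n.+1) zeta =
      w * t + dotv v (\row_i zeta 0 (lift ord0 i)).
    rewrite /dotv big_ord_recl E0 mulrC; congr (_ + _).
    by apply: eq_bigr => i _; rewrite [in RHS]mxE; congr (_ * _); exact: ES.
  by rewrite mulrA addrA.
have [j ->|->] := unliftP ord0 i.
  move=> fv; have [|-> ->] := AB0; first by exists j; rewrite mxE.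
  by rewrite !mul0r addr0 subr0.
by rewrite -/w => -[al0 be0]; rewrite /al /be al0 be0 !mulr0 addr0 subr0.
Qed.

Definition real_cfun n (f : 'I_n -> R -> R) : cfun R n := (tensor n f, fun=> 0).

Lemma cintegrable_tensor n (f : 'I_n -> R -> R) :
  (forall i, L1 (f i)) -> cintegrable (real_cfun n f).
Proof.
move=> If.
(* At frequency zero with absolute values as factors, the formula shows that the integral of the
   norm is a real number. *)
have [A [B [AB _]]] := iint_tensor n (fun i t => `|f i t|) 0 (fun i => L1_norm _ (If i)).
rewrite /cintegrable; have := AB 1 0.
rewrite (_ : (fun z => _) = fun z =>
  (`|(real_cfun n f).1 z| + `|(real_cfun n f).2 z|)%:E) => [->|].
  exact: ltry.
apply/funext => z; congr EFin; rewrite /real_cfun /= normr0 addr0 mul1r add0r.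
rewrite /dotv big1 => [|i _]; last by rewrite mxE mulr0.
by rewrite cos0 mulr1 /tensor normr_prod.
Qed.

Lemma fourier_nonzero_tensor n (f : 'I_n -> R -> R) zeta i :
  (forall i, L1 (f i)) -> fourier_nonzero (real_cfun n f) zeta ->
  ~ fourier_vanishes (f i) (zeta 0 i).
Proof.
move=> If nz fv; have [A [B [AB AB0]]] := iint_tensor n f zeta If.
have [A0 B0] := AB0 (ex_intro _ i fv).
have {}AB th : iint (fun z => (1 * tensor n f z * cos (th + dotv z zeta))%:E) = 0%E.
  by rewrite AB A0 B0 !mul0r addr0 mulr0.
case: nz => /eqP; apply.
- rewrite -(AB 0); congr iint; apply/funext => z; congr EFin.
  by rewrite /= mul0r addr0 mul1r add0r.
(* The phase [pi / 2] turns the cosine into minus the sine, which gives the imaginary part. *)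
- rewrite -(AB (pi / 2)); congr iint; apply/funext => z; congr EFin.
  by rewrite /= mul0r sub0r mul1r addrC cosDpihalf mulrN.
Qed.

End Tensor.

(** * Closed coordinate conditions and membership in the cone *)

Lemma iterD_cst0 (R : realType) n (s : seq 'I_n) :
  Defs.iterD s (fun _ : 'rV[R]_n => 0) = fun=> 0.
Proof.
elim: s => //= i s ->; apply/funext => z.
by rewrite derive_cst.
Qed.

Lemma smooth_cst0 (R : realType) n : smooth (fun _ : 'rV[R]_n => (0 : R)).
Proof.
split=> [s z i|s]; rewrite iterD_cst0; last exact: cst_continuous.
exact: derivable_cst.
Qed.

Lemma closure_coord (R : realType) n (S : set 'rV[R]_n) (A : set R) i :
  closed A -> (forall z, S z -> A (z 0 i)) -> forall z, closure S z -> A (z 0 i).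
Proof.
move=> cA SA z Sz.
have cB : closed [set z : 'rV[R]_n | A (z 0 i)].
  apply: (preimage_closed (f := fun z : 'rV[R]_n => z 0 i)) => // x _.
  exact: coord_continuous.
by move/closure_id: cB => cB; suff : [set z : 'rV[R]_n | A (z 0 i)] z by [];
  rewrite cB; exact: closureS Sz.
Qed.

Lemma closed_norm_le (R : realType) (b : R) : closed [set x : R | `|x| <= b].
Proof.
apply: (preimage_closed (f := fun x : R => `|x|) (D := [set x | x <= b])).
  by move=> x _; exact: norm_continuous.
exact: closed_le.
Qed.

Lemma closed_norm_ge (R : realType) (b : R) : closed [set x : R | b <= `|x|].
Proof.
apply: (preimage_closed (f := fun x : R => `|x|) (D := [set x | b <= x])).
  by move=> x _; exact: norm_continuous.
exact: closed_ge.
Qed.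

Lemma cone_coord (R : realType) m l (i : 'I_m) (b : R) (zeta : 'rV[R]_(m + l)) :
  0 <= b -> l%:R * b ^+ 2 + 1 <= `|zeta 0 (lshift l i)| ->
  (forall j, `|zeta 0 (rshift m j)| <= b) -> @cone R m l zeta.
Proof.
move=> b0 zi zj; rewrite /cone /= /enorm.
have lb : 0 <= l%:R * b ^+ 2 by rewrite mulr_ge0// exprn_ge0.
have S1 : \sum_(j < l) rsubmx zeta 0 j ^+ 2 <= l%:R * b ^+ 2.
  rewrite -[l in l%:R]card_ord mulr_natl -sumr_const; apply: ler_sum => j _.
  rewrite mxE -real_normK ?num_real//.
  by rewrite ler_pXn2r// ?nnegrE//; exact: zj.
have S2 : `|zeta 0 (lshift l i)| ^+ 2 <= \sum_(j < m) lsubmx zeta 0 j ^+ 2.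
  rewrite (bigD1 i)//= mxE real_normK ?num_real// lerDl.
  by apply: sumr_ge0 => j _; exact: sqr_ge0.
(* The summand [1] in the hypothesis makes the coordinate at least [1] in modulus, so its square
   dominates it; this avoids a square root of [l]. *)
have S3 : l%:R * b ^+ 2 < `|zeta 0 (lshift l i)| ^+ 2 by nra.
by rewrite ltr_sqrt; lra.
Qed.

(** * Construction of the Cauchy data *)

Theorem theorem10 (R : realType) (d1 d2 p1 p2 k : nat) :
  (1 <= d1)%N -> (1 <= d2)%N -> (p1 <= d1)%N -> (p2 <= d2 - 1)%N ->
  (1 <= (d1 - p1) + (d2 - 1 - p2))%N ->
  exists u0 u1 : cfun R (d1 + (d2 - 1)),
    [/\ csmooth u0 /\ csmooth u1,
        cintegrable u0 /\ cintegrable u1,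
        ~ czero_pair u0 u1,
        fourier_supp u0 `|` fourier_supp u1 `<=` @cone R d1 (d2 - 1)
      & vanish_to_order k (@Mset R d1 d2 p1 p2) u0 /\
        vanish_to_order k (@Mset R d1 d2 p1 p2) u1].
Proof.
move=> d1_gt0 _ p1d1 p2d2 codim.
pose l := (d2 - 1)%N; rewrite -/l in p2d2 codim *.
(* [wave k.+1] is flat enough for order [k], and its band has half-width [k.+2]. The modulation [a]
   exceeds [b] by exactly the margin that [cone_coord] asks for. *)
pose b : R := k.+2%:R.
pose a : R := b + (l%:R * b ^+ 2 + 1).
pose i0 : 'I_d1 := Ordinal d1_gt0.
pose freq (i : 'I_(d1 + l)) : R := if i == lshift l i0 then a else 0.
pose f i := wave k.+1 (freq i).
have b0 : 0 <= b by rewrite ler0n.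
have a0 : 0 < a by rewrite /a ltr_wpDl// ltr_wpDl// mulr_ge0// exprn_ge0.
have sf i : smooth1 (f i) by exact: smooth1_wave.
have If i : L1 (f i) by exact: L1_wave.
pose u := real_cfun (d1 + l) f.
have csu : csmooth u by split; [exact: smooth_tensor|exact: smooth_cst0].
have ciu : cintegrable u by exact: cintegrable_tensor.
have spec zeta i : fourier_nonzero u zeta ->
    `|zeta 0 i + freq i| < b \/ `|zeta 0 i - freq i| < b.
  move=> /(fourier_nonzero_tensor _ f zeta i If) nv; apply: contrapT.
  move=> /not_orP[/negP + /negP]; rewrite -!leNgt => h1 h2.
  by apply: nv; exact: fourier_vanishes_wave.
have vanu : vanish_to_order k (@Mset R d1 d2 p1 p2) u.
  move=> s sk z Mz; rewrite iterD_tensor// iterD_cst0; split=> //.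
  (* The codimension hypothesis provides a coordinate in [x''] or, failing that, in [y'']. *)
  have [i zi] : exists i, z 0 i = 0.
    have [p1d|d1p] := ltnP p1 d1.
      exists (lshift l (Ordinal p1d)); apply: Mz => /=.
      by rewrite leqnn p1d.
    have p2l : (p2 < l)%N by move: codim; rewrite (eqP d1p) add0n subn_gt0.
    exists (rshift d1 (Ordinal p2l)); apply: Mz => /=.
    by rewrite leqnn orbT.
  rewrite /tensor (bigD1 i)//= zi flat_wave ?mul0r// ltnS.
  by rewrite (leq_trans (count_size _ _)).
exists u, u; split=> //.
(* A point near the origin with equal coordinates, so small that [a] times each stays below [1]: no
   factor vanishes there. *)
- move=> [/(_ (const_mx (2 * (a + 1))^-1))[/eqP + _] _]; apply/negP.
  have t0 : 0 < (2 * (a + 1))^-1 by rewrite invr_gt0; lra.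
  apply/prodf_neq0 => i _; rewrite mxE; apply: wave_neq0.
    by rewrite t0 invf_le1; lra.
  have fa : 0 <= freq i <= a by rewrite /freq; case: ifP => _; lra.
  rewrite ger0_norm; last by rewrite mulr_ge0 ?(ltW t0)//; case/andP: fa.
  by rewrite ltr_pdivrMr; lra.
(* The strict bounds on the spectrum are weakened to closed ones, which pass to the closure; the gap
   between them still gives the open cone. *)
- rewrite setUid => zeta sz; apply: (cone_coord _ _ _ i0 b) => // [|j].
    apply: (closure_coord _ _ _ _ (lshift l i0) (closed_norm_ge _ _) _ _ sz).
    move=> z /(spec _ (lshift l i0)); rewrite /freq eqxx /= => h.
    have : a - `|z 0 (lshift l i0)| < b.
      case: h => h; apply: le_lt_trans h.
        rewrite -[X in X - _](gtr0_norm a0) -[X in _ - X]normrN.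
        by apply: le_trans (lerB_dist _ _) _; rewrite opprK addrC.
      rewrite -[X in X - _](gtr0_norm a0) distrC; exact: lerB_dist.
    by rewrite /a; lra.
  apply: (closure_coord _ _ _ _ (rshift d1 j) (closed_norm_le _ _) _ _ sz).
  move=> z /(spec _ (rshift d1 j)); rewrite /freq eq_rlshift addr0 subr0.
  by case=> /ltW.
Qed.
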